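(* Let $A$ and $B$ be two nonempty, closed, bounded and convex subsets of a uniformly convex Banach space $X$ such that $A_0 \times B_0$ is compact. Let $S:(A \times B) \cup (B \times A) \rightarrow A \cup B$ be a p-cyclic nonexpansive mapping. Then $S$ has a coupled best proximity point. Moreover, the coupled best proximity point problem for $S$ is Ulam-Hyers stable.
   Context: For nonempty subsets $A,B$ of a Banach space $(X,\Vert\cdot\Vert)$, $dist(A,B):=\inf\{\Vert a-b\Vert : a\in A,\ b\in B\}$, $A_0:=\{a\in A:\Vert a-b\Vert=dist(A,B)\text{ for some }b\in B\}$ and $B_0:=\{b\in B:\Vert a-b\Vert=dist(A,B)\text{ for some }a\in A\}$. The space $X\times X$ carries the norm $\Vert (x,y)\Vert=\max\{\Vert x\Vert,\Vert y\Vert\}$. p-cyclic nonexpansive: a mapping $S:(A \times B) \cup (B \times A) \rightarrow A \cup B$ is a p-cyclic nonexpansive mapping if (i) $S(A\times B)\subset B$ and $S(B\times A)\subset A$; (ii) $\Vert S(x_1,y_1)-S(x_2,y_2)\Vert\le\Vert (x_1,y_1)-(x_2,y_2)\Vert$ for all $(x_1,y_1),(x_2,y_2)\in (A\times B)\cup(B\times A)$. Coupled best proximity point (or pair) of $S$: a pair $(x,y)\in A\times B$ with $\Vert x-S(x,y)\Vert=dist(A,B)$ and $\Vert y-S(y,x)\Vert=dist(A,B)$. Ulam-Hyers stability: the coupled best proximity point problem for $S$ is Ulam-Hyers stable if for each $\epsilon>0$ and each $(u,v)\in A\times B$ satisfying $\Vert u-S(u,v)\Vert\le\epsilon+dist(A,B)$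 and $\Vert v-S(v,u)\Vert\le\epsilon+dist(A,B)$, there exist $\alpha,\beta>0$ and a coupled best proximity point $(x^*,y^* )$ of $S$ such that $\Vert x^*-u\Vert\le\alpha\epsilon+\beta\, dist(A,B)$ and $\Vert y^*-v\Vert\le\alpha\epsilon+\beta\, dist(A,B)$. *)

(* Defs.v *)
From HB Require Import structures.
From mathcomp Require Import all_boot all_order all_algebra.
From mathcomp Require Import all_classical all_reals all_analysis.

Set Implicit Arguments.
Unset Strict Implicit.
Unset Printing Implicit Defensive.

Import Order.TTheory GRing.Theory Num.Theory.
Import numFieldNormedType.Exports.

Local Open Scope classical_set_scope.
Local Open Scope ring_scope.

Definition uniformly_convex (R : realType) (X : normedModType R) : Prop :=
  forall e : R, 0 < e -> e <= 2 ->
    exists2 d : R, 0 < d &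
      forall x y : X, `|x| <= 1 -> `|y| <= 1 -> e <= `|x - y| ->
        `|2^-1 *: (x + y)| <= 1 - d.

Definition set_dist (R : realType) (X : normedModType R) (A B : set X) : R :=
  inf [set `|a - b| | a in A & b in B].

(* The sets usually written A_0 and B_0. *)
Definition proxl (R : realType) (X : normedModType R) (A B : set X) : set X :=
  [set a | A a /\ exists2 b, B b & `|a - b| = set_dist A B].

Definition proxr (R : realType) (X : normedModType R) (A B : set X) : set X :=
  [set b | B b /\ exists2 a, A a & `|a - b| = set_dist A B].

(* S is a total function on X * X of which only the values on
   (A `*` B) `|` (B `*` A) matter.  The norm on X * X is the max norm. *)
Definition p_cyclic_nonexpansive (R : realType) (X : normedModType R)
    (A B : set X) (S : X * X -> X) : Prop :=
  [/\ S @` (A `*` B) `<=` B,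
      S @` (B `*` A) `<=` A &
      forall p q : X * X,
        ((A `*` B) `|` (B `*` A)) p -> ((A `*` B) `|` (B `*` A)) q ->
        `|S p - S q| <= `|p - q| ].

Definition coupled_best_proximity_point (R : realType) (X : normedModType R)
    (A B : set X) (S : X * X -> X) (p : X * X) : Prop :=
  [/\ (A `*` B) p,
      `|p.1 - S (p.1, p.2)| = set_dist A B &
      `|p.2 - S (p.2, p.1)| = set_dist A B ].

Definition ulam_hyers_stable (R : realType) (X : normedModType R)
    (A B : set X) (S : X * X -> X) : Prop :=
  forall (e : R) (u v : X), 0 < e -> A u -> B v ->
    `|u - S (u, v)| <= e + set_dist A B ->
    `|v - S (v, u)| <= e + set_dist A B ->
    exists alpha beta : R, [/\ 0 < alpha, 0 < beta &
      exists x y : X, [/\ coupled_best_proximity_point A B S (x, y),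
        `|x - u| <= alpha * e + beta * set_dist A B &
        `|y - v| <= alpha * e + beta * set_dist A B ] ].

(* Main.v *)
(* Uniform convexity gives a proximal pair and shows that A - B has a unique
   element h of minimal norm; hence A_0 = B_0 + h, and translating by h and -h
   turns p |-> (S p, S (p.2, p.1)) into a nonexpansive self-map of the compact
   convex set A_0 x B_0.  Such a map has a fixed point: it minimizes the
   displacement |f p - p|, whose infimum is 0 because the contractions
   t z + (1 - t) f have fixed points.  A fixed point of the translated map is a
   coupled best proximity point.  In the stability notion alpha and beta may
   depend on e, u and v, so any coupled best proximity point will do. *)
Require Import Defs.
From HB Require Import structures.
From mathcomp Require Import all_boot all_order all_algebra.
From mathcomp Require Import all_classical all_reals all_analysis.
From mathcomp Require Import lra.

Set Implicit Arguments.
Unset Strict Implicit.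
Unset Printing Implicit Defensive.

Import Order.TTheory GRing.Theory Num.Theory.
Import numFieldNormedType.Exports.

Local Open Scope classical_set_scope.
Local Open Scope ring_scope.

(** * Near-minimal norms in a uniformly convex space *)

(** Uniform convexity rescaled from the unit ball to radius [r + d]. For [r = 0] the triangle
    inequality suffices. *)
Lemma uniformly_convex_close (R : realType) (X : normedModType R) (r e : R) :
  uniformly_convex X -> 0 <= r -> 0 < e ->
  exists2 d : R, 0 < d & forall x y : X, `|x| <= r + d -> `|y| <= r + d ->
    r - d <= `|2^-1 *: (x + y)| -> `|x - y| < e.
Proof.
move=> hX; rewrite le_eqVlt => /predU1P[<- e0|r0 e0].
  exists (e / 3); first by rewrite divr_gt0.
  move=> x y hx hy _; have := ler_normB x y; lra.
have k0 : 0 < r + 1 by lra.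
(* The cap at 2 is the range on which the modulus of convexity is given. *)
have [||d' d'0 hd'] := hX (Num.min (e / (r + 1)) 2).
- by rewrite lt_min divr_gt0//=; lra.
- by rewrite ge_min lexx orbT.
have rd0 : 0 < r * d' by rewrite mulr_gt0.
(* The bound [d <= 1] gives [e / (r + 1) <= e / (r + d)], and [4 * d <= r * d'] puts
   [(r + d) * (1 - d')] strictly below [r - d]. *)
exists (Num.min 1 (r * d' / 4)); first by rewrite lt_min; lra.
set d := Num.min _ _ => x y hx hy hxy.
have d0 : 0 < d by rewrite /d lt_min; lra.
have d1 : d <= 1 by rewrite /d ge_min lexx.
have d2 : d <= r * d' / 4 by rewrite /d ge_min lexx orbT.
have s0 : 0 < r + d by lra.
have scale (v : X) : `|(r + d)^-1 *: v| = (r + d)^-1 * `|v| :> R.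
  by rewrite normrZ gtr0_norm// invr_gt0.
rewrite ltNge; apply/negP => exy.
have := hd' ((r + d)^-1 *: x) ((r + d)^-1 *: y).
rewrite -scalerBr -scalerDr scalerA [2^-1 * _]mulrC -scalerA !scale.
rewrite ![_^-1 * _]mulrC !ler_pdivrMr// !mul1r => /(_ hx hy).
suff -> : Num.min (e / (r + 1)) 2 <= `|x - y| / (r + d).
  move=> /(_ isT) hm; have := mulr_gt0 d0 d'0; nra.
rewrite ge_min; apply/orP; left.
rewrite ler_pM ?invr_ge0 ?(ltW e0) ?(ltW k0)// lef_pV2 ?posrE//; lra.
Qed.

(* A substitute for weak compactness: points of [C e] of almost minimal norm
   form a Cauchy filter as [e] tends to [0]. *)
Lemma uniformly_convex_bigcap_closure (R : realType)
    (X : completeNormedModType R) (C : R -> set X) (M : R) :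
  uniformly_convex X ->
  (forall e, 0 < e -> C e !=set0) ->
  (forall e e', e <= e' -> C e `<=` C e') ->
  (forall e x y, C e x -> C e y -> C e (2^-1 *: (x + y))) ->
  (forall e x, C e x -> `|x| <= M) ->
  exists x, forall e, 0 < e -> closure (C e) x.
Proof.
move=> hX C0 Cle Cmid CM.
(* The supremum [r] of [L] is the limit, as [e] tends to 0, of the infimum of the norm on [C e]. *)
pose L := [set t : R | exists2 e, 0 < e & forall x, C e x -> t <= `|x|].
have supL : has_sup L.
  split; first by exists 0, 1.
  exists M => t [e e0 he]; have [x Cx] := C0 _ e0.
  exact: le_trans (he _ Cx) (CM _ _ Cx).
pose r := sup L.
have r0 : 0 <= r by apply: sup_upper_bound => //; exists 1.
pose G (e : R) := C e `&` [set x | `|x| <= r + e].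
pose F := filter_from [set e : R | 0 < e] G.
(* If [G e] were empty, [r + e] would be a lower bound of the norm on [C e], hence an element of [L]
   above its supremum. *)
have G0 e : 0 < e -> G e !=set0.
  move=> e0; apply: contrapT => hG.
  suff : r + e <= r by rewrite gerDl leNgt e0.
  apply: sup_upper_bound => //; exists e => // x Cx.
  by rewrite leNgt; apply/negP => hx; apply: hG; exists x; split => //=; exact: ltW.
have GS e e' : e <= e' -> G e `<=` G e'.
  move=> ee' x [Cx /= hx]; split; first exact: (Cle e).
  by apply: le_trans hx _; rewrite lerD2l.
have FF : ProperFilter F.
  apply: filter_from_proper; last by move=> e /G0.
  apply: filter_from_filter; first by exists 1; exact: ltr01.
  move=> e e' /= e0 e'0; exists (Num.min e e'); first by rewrite /= lt_min e0.
  by move=> x Gx; split; apply: GS Gx; rewrite ge_min lexx ?orbT.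
have Fcvg : cvg F.
  apply/cauchy_cvgP; apply: cauchy_exP => e e0.
  have [d d0 hd] := uniformly_convex_close hX r0 e0.
  (* On [C e1] all norms are at least [t > r - d]. Midpoints stay in [C e1], so any two points of
     [G (Num.min d e1)] are closer than [e]. *)
  have [t [e1 e10 ht] rt] := sup_adherent d0 supL.
  have m0 : 0 < Num.min d e1 by rewrite lt_min d0.
  have [x Gx] := G0 _ m0; exists x; exists (Num.min d e1) => // y Gy.
  have Gd z : G (Num.min d e1) z -> `|z| <= r + d.
    by move=> Gz; have [] := GS _ d _ z Gz; rewrite // ge_min lexx.
  have Ge z : G (Num.min d e1) z -> C e1 z.
    by move=> Gz; have [] := GS _ e1 _ z Gz; rewrite // ge_min lexx orbT.
  rewrite -ball_normE; apply: hd; [exact: Gd|exact: Gd|].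
  by apply: le_trans (ltW rt) (ht _ _); apply: Cmid; exact: Ge.
exists (lim F) => e e0 U /Fcvg FU.
have : F (C e `&` U) by apply: filterI => //; exists e => // x [].
by move=> /filter_ex.
Qed.

(** * Fixed points of nonexpansive maps on compact sets *)

Section fixpoint.
Variables (R : realType) (V : normedModType R) (K : set V).
Hypotheses (K0 : K !=set0) (Kcpt : compact K).

Lemma nonexpansive_min_displacement (f : V -> V) :
  (forall x y, K x -> K y -> `|f x - f y| <= `|x - y|) ->
  exists2 c, K c & forall x, K x -> `|f c - c| <= `|f x - x|.
Proof.
move=> hf.
have [|c] := @compact_EVT_min _ _ (fun x => `|f x - x|) K K0 Kcpt.
  apply/subspace_continuousP => x Kx.
  have cf : f y @[y --> within K (nbhs x)] --> f x.
    apply/cvgrPdist_le => e e0; near=> y.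
    have Ky : K y by near: y; exact: withinT.
    apply: le_trans (hf _ _ Kx Ky) _.
    near: y; apply: cvg_within.
    by have /cvgrPdist_le := @cvg_id _ (nbhs x); exact.
  apply: cvg_norm; apply: cvgB => //; exact: cvg_within.
by rewrite inE => Kc hc; exists c => // x Kx; apply: hc; rewrite inE.
Unshelve. all: by end_near. Qed.

(** If [c] has least displacement, that of [f c] is at most [q] times as large; minimality forces it
    to be 0. *)
Lemma compact_contraction_fixpoint (q : R) (f : V -> V) :
  q < 1 -> (forall x, K x -> K (f x)) ->
  (forall x y, K x -> K y -> `|f x - f y| <= q * `|x - y|) ->
  exists2 x, K x & f x = x.
Proof.
move=> q1 Kf hf.
have [|c Kc hc] := @nonexpansive_min_displacement f.
  move=> x y Kx Ky; apply: le_trans (hf _ _ Kx Ky) _.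
  by rewrite ler_piMl// ltW.
exists c => //; apply/eqP; rewrite -subr_eq0 -normr_le0 leNgt; apply/negP => p0.
have := le_trans (hc _ (Kf _ Kc)) (hf _ _ (Kf _ Kc) Kc).
by rewrite ler_pMl// leNgt q1.
Qed.

Lemma compact_starshaped_nonexpansive_fixpoint (z : V) (f : V -> V) :
  K z ->
  (forall (t : R) x, 0 <= t -> t <= 1 -> K x -> K (t *: z + (1 - t) *: x)) ->
  (forall x, K x -> K (f x)) ->
  (forall x y, K x -> K y -> `|f x - f y| <= `|x - y|) ->
  exists2 x, K x & f x = x.
Proof.
move=> Kz Kstar Kf hf.
have [c Kc hc] := nonexpansive_min_displacement hf.
exists c => //; apply/eqP; rewrite -subr_eq0 -normr_le0 leNgt; apply/negP.
set m := `|f c - c| in hc * => m0.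
have [M M0 hM] : exists2 M : R, 0 < M & forall x, K x -> `|x| <= M.
  have [M M0 hM] := ex_strict_bound_gt0 (compact_bounded Kcpt).
  by exists M => // x Kx; apply: ltW; exact: hM.
(* With this [t], the fixed point [x] of the contraction satisfies [f x - x = t *: (f x - z)], of
   norm at most [t * (2 * M) < m], against the minimality of [m]. *)
pose t := m / (m + 2 * M).
have s0 : 0 < m + 2 * M by lra.
have t0 : 0 < t by rewrite divr_gt0.
have t1 : t <= 1 by rewrite ler_pdivrMr//; lra.
have [|||x Kx hx] :=
    @compact_contraction_fixpoint (1 - t) (fun x => t *: z + (1 - t) *: f x).
- by lra.
- by move=> x Kx; apply: Kstar (Kf _ Kx) => //; exact: ltW.
- move=> x y Kx Ky; rewrite opprD addrACA subrr add0r -scalerBr normrZ.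
  by rewrite ger0_norm ?subr_ge0// ler_wpM2l ?subr_ge0// hf.
have e : f x - x = t *: (f x - z).
  rewrite -{2}hx scalerBl scale1r scalerBr opprD opprB.
  by rewrite addrCA [f x + _]addrC subrK addrC.
have := hc _ Kx; rewrite e normrZ gtr0_norm// leNgt; apply/negP; rewrite negbK.
have fz : `|f x - z| <= 2 * M.
  by apply: le_trans (ler_normB _ _) _; have := hM _ (Kf _ Kx); have := hM _ Kz; lra.
apply: le_lt_trans (_ : t * (2 * M) < m).
  by rewrite ler_wpM2l// ltW.
by rewrite /t mulrAC ltr_pdivrMr// ltr_pM2l//; lra.
Qed.

End fixpoint.

(** * The distance between two sets *)

Section proximal.
Variables (R : realType) (X : normedModType R) (A B : set X).

Lemma has_lbound_dist : has_lbound [set `|a - b| | a in A & b in B].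
Proof. by exists 0 => _ [a _ [b _ <-]]. Qed.

Lemma set_dist_le a b : A a -> B b -> set_dist A B <= `|a - b|.
Proof.
by move=> Aa Bb; apply: ge_inf has_lbound_dist _ _; exists a => //; exists b.
Qed.

Hypotheses (A0 : A !=set0) (B0 : B !=set0).

Lemma has_inf_dist : has_inf [set `|a - b| | a in A & b in B].
Proof.
split; last exact: has_lbound_dist.
by have [[a Aa] [b Bb]] := (A0, B0); exists `|a - b|, a => //; exists b.
Qed.

Lemma set_dist_ge0 : 0 <= set_dist A B.
Proof.
by apply: lb_le_inf; [have [] := has_inf_dist|move=> _ [a _ [b _ <-]]].
Qed.

Lemma set_dist_approx (e : R) : 0 < e ->
  exists a b, [/\ A a, B b & `|a - b| < set_dist A B + e].
Proof.
move=> e0; have [_ [a Aa [b Bb <-]] h] := inf_adherent e0 has_inf_dist.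
by exists a, b.
Qed.

End proximal.

(** * Proximal pairs of convex sets *)

Lemma convex_setP (R : realType) (X : normedModType R) (A : set X) :
  convex_set (A : set (convex_lmodType X)) ->
  forall (t : R) x y, 0 <= t -> t <= 1 -> A x -> A y ->
    A (t *: x + (1 - t) *: y).
Proof.
move=> cA t x y t0 t1 Ax Ay.
have := cA x y (Itv01 t0 t1); rewrite !inE; exact.
Qed.

Lemma convex_set_half (R : realType) (X : normedModType R) (A : set X) :
  convex_set (A : set (convex_lmodType X)) ->
  forall x y, A x -> A y -> A (2^-1 *: (x + y)).
Proof.
move=> cA x y Ax Ay; have := convex_setP cA (t := 2^-1) _ _ Ax Ay.
rewrite scalerDr; have -> : 1 - 2^-1 = 2^-1 :> R by lra.
by apply; lra.
Qed.

(** [uniformly_convex_bigcap_closure] is used twice: on the points of [A] within [d + e] of [B],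
    which yields [a], then on the points of [B] within [d + e] of this [a], which yields [b]. *)
Lemma exists_proximal_pair (R : realType) (X : completeNormedModType R)
    (A B : set X) :
  uniformly_convex X -> A !=set0 -> B !=set0 -> closed A -> closed B ->
  bounded_set A -> bounded_set B ->
  convex_set (A : set (convex_lmodType X)) ->
  convex_set (B : set (convex_lmodType X)) ->
  exists a b, [/\ A a, B b & `|a - b| = set_dist A B].
Proof.
move=> hX A0 B0 Acl Bcl Abd Bbd Acv Bcv; set d := set_dist A B.
have bnd (E : set X) : bounded_set E -> exists M : R, forall x, E x -> `|x| <= M.
  move=> /ex_strict_bound_gt0[M _ hM]; exists M => x Ex.
  by apply: ltW; exact: hM.
have [[MA hMA] [MB hMB]] := (bnd _ Abd, bnd _ Bbd).
have half_norm (x y : X) (r : R) :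
    `|x| < r -> `|y| < r -> `|2^-1 *: (x + y)| < r.
  move=> hx hy; rewrite normrZ ger0_norm ?invr_ge0//.
  have := ler_normD x y; lra.
have half_sub (a a' b b' : X) :
    2^-1 *: (a + a') - 2^-1 *: (b + b') = 2^-1 *: ((a - b) + (a' - b')).
  by rewrite -scalerBr opprD addrACA.
have [||||a ha] := @uniformly_convex_bigcap_closure _ _
    (fun e => [set a | A a /\ exists2 b, B b & `|a - b| < d + e]) MA hX.
- move=> e e0; have [a [b [Aa Bb hab]]] := set_dist_approx A0 B0 e0.
  by exists a; split => //; exists b.
- move=> e e' ee' a [Aa [b Bb hab]]; split => //; exists b => //.
  by apply: lt_le_trans hab _; rewrite lerD2l.
- move=> e a a' [Aa [b Bb hab]] [Aa' [b' Bb' hab']].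
  split; first exact: convex_set_half.
  exists (2^-1 *: (b + b')); first exact: convex_set_half.
  by rewrite half_sub half_norm.
- by move=> e a [/hMA].
have Aa : A a.
  by apply: Acl => U /(ha 1 ltr01)[x [[Ax _] Ux]]; exists x.
have near_a e : 0 < e -> exists2 b, B b & `|a - b| < d + e.
  move=> e0; have e20 : 0 < e / 2 by rewrite divr_gt0.
  have [x [[_ [b Bb hxb]] hax]] := ha _ e20 _ (nbhsx_ballx a _ e20).
  exists b => //; move: hax; rewrite -ball_normE /= => hax.
  have := ler_distD x a b; lra.
have [||||b hb] := @uniformly_convex_bigcap_closure _ _
    (fun e => B `&` [set b | `|a - b| < d + e]) MB hX.
- by move=> e /near_a[b Bb hb]; exists b.
- move=> e e' ee' b [Bb hab]; split => //=.
  by apply: lt_le_trans hab _; rewrite lerD2l.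
- move=> e b b' [Bb hb] [Bb' hb']; split; first exact: convex_set_half.
  (* The midpoint of [a - b] and [a - b'] is [a] minus the midpoint of [b] and [b']. *)
  have /= := half_norm _ _ _ hb hb'.
  rewrite -half_sub scalerDr -scalerDl (_ : 2^-1 + 2^-1 = 1 :> R) ?scale1r//.
  by lra.
- by move=> e b [/hMB].
have Bb : B b.
  by apply: Bcl => U /(hb 1 ltr01)[x [[Bx _] Ux]]; exists x.
exists a, b; split => //; apply/eqP; rewrite eq_le set_dist_le// andbT.
apply/ler_addgt0Pr => e e0; have e20 : 0 < e / 2 by rewrite divr_gt0.
have [x [[_ /= hxa] hbx]] := hb _ e20 _ (nbhsx_ballx b _ e20).
move: hbx; rewrite -ball_normE /= distrC => hbx.
have := ler_distD x a b; rewrite -/d; lra.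
Qed.

Section proximal_convex.
Variables (R : realType) (X : normedModType R) (A B : set X).
Hypotheses (Acv : convex_set (A : set (convex_lmodType X)))
           (Bcv : convex_set (B : set (convex_lmodType X))).

(** The midpoint of the two differences is again a difference of points of [A] and [B], so its norm
    is at least the distance; uniform convexity then makes the differences arbitrarily close. *)
Lemma proximal_sub_unique a b a' b' :
  uniformly_convex X -> A a -> B b -> A a' -> B b' ->
  `|a - b| = set_dist A B -> `|a' - b'| = set_dist A B ->
  a - b = a' - b'.
Proof.
move=> hX Aa Bb Aa' Bb' hab hab'; apply/eqP; rewrite -subr_eq0 -normr_le0.
apply/ler_addgt0Pr => e e0; rewrite add0r.
have d0 : 0 <= set_dist A B by rewrite -hab.
have [d dgt0 hd] := uniformly_convex_close hX d0 e0.
apply/ltW/hd; rewrite ?hab ?hab' ?lerDl ?(ltW dgt0)//.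
apply: le_trans (_ : set_dist A B <= _); first by rewrite gerBl ltW.
rewrite addrACA -opprD scalerBr.
by apply: set_dist_le; exact: convex_set_half.
Qed.

Lemma proximal_convex (t : R) a b a' b' : 0 <= t -> t <= 1 ->
  A a -> B b -> A a' -> B b' ->
  `|a - b| = set_dist A B -> `|a' - b'| = set_dist A B ->
  `|(t *: a + (1 - t) *: a') - (t *: b + (1 - t) *: b')| = set_dist A B.
Proof.
move=> t0 t1 Aa Bb Aa' Bb' hab hab'; apply/eqP; rewrite eq_le.
rewrite set_dist_le ?andbT; [|exact: convex_setP..].
rewrite opprD addrACA -!scalerBr (le_trans (ler_normD _ _))//.
rewrite !normrZ hab hab' !ger0_norm ?subr_ge0// -mulrDl.
by rewrite addrC subrK mul1r.
Qed.

Lemma proxl_convex (t : R) a a' : 0 <= t -> t <= 1 ->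
  proxl A B a -> proxl A B a' -> proxl A B (t *: a + (1 - t) *: a').
Proof.
move=> t0 t1 [Aa [b Bb hab]] [Aa' [b' Bb' hab']].
split; first exact: convex_setP.
exists (t *: b + (1 - t) *: b'); first exact: convex_setP.
exact: proximal_convex.
Qed.

Lemma proxr_convex (t : R) b b' : 0 <= t -> t <= 1 ->
  proxr A B b -> proxr A B b' -> proxr A B (t *: b + (1 - t) *: b').
Proof.
move=> t0 t1 [Bb [a Aa hab]] [Bb' [a' Aa' hab']].
split; first exact: convex_setP.
exists (t *: a + (1 - t) *: a'); first exact: convex_setP.
exact: proximal_convex.
Qed.

End proximal_convex.

(** * Coupled best proximity points and Ulam-Hyers stability *)

Lemma exists_coupled_best_proximity_point
    (R : realType) (X : completeNormedModType R) (A B : set X) (S : X * X -> X) :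
  uniformly_convex X -> A !=set0 -> B !=set0 -> closed A -> closed B ->
  bounded_set A -> bounded_set B ->
  convex_set (A : set (convex_lmodType X)) ->
  convex_set (B : set (convex_lmodType X)) ->
  compact (proxl A B `*` proxr A B) -> p_cyclic_nonexpansive A B S ->
  exists p : X * X, coupled_best_proximity_point A B S p.
Proof.
move=> hX A0 B0 Acl Bcl Abd Bbd Acv Bcv Kcpt [SAB SBA Snexp].
have [a0 [b0 [Aa0 Bb0 hab0]]] :=
  exists_proximal_pair hX A0 B0 Acl Bcl Abd Bbd Acv Bcv.
set d := set_dist A B in hab0; pose h := a0 - b0.
have proxlP a : proxl A B a -> A a /\ B (a - h).
  move=> [Aa [b Bb hab]]; split => //; rewrite /h.
  by rewrite -(proximal_sub_unique Acv Bcv hX Aa Bb Aa0 Bb0 hab hab0) subKr.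
have proxrP b : proxr A B b -> B b /\ A (b + h).
  move=> [Bb [a Aa hab]]; split => //; rewrite /h.
  by rewrite -(proximal_sub_unique Acv Bcv hX Aa Bb Aa0 Bb0 hab hab0) addrC subrK.
(* A pair at distance at most [d] is proximal, so its difference is [h]: [b + h] is [a] and [a - h]
   is [b]. *)
have proxl_sub a b : A a -> B b -> `|a - b| <= d ->
    proxl A B (b + h) /\ proxr A B (a - h).
  move=> Aa Bb hab.
  have e : `|a - b| = set_dist A B by apply/eqP; rewrite eq_le hab set_dist_le.
  have eh : h = a - b by apply: (proximal_sub_unique Acv Bcv hX).
  rewrite eh [b + _]addrC subrK subKr.
  by split; split => //; [exists b|exists a].
pose f (p : X * X) := (S p + h, S (p.2, p.1) - h).
have f_prox p : (proxl A B `*` proxr A B) p -> (proxl A B `*` proxr A B) (f p).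
  case: p => x y [/= /proxlP[Ax Bx] /proxrP[By Ay]].
  (* Replacing [(x, y)] by [(x - h, y + h)] swaps [A] and [B] and moves each coordinate by exactly
     [d]. By nonexpansiveness the two values of [S], one in each set, are within [d], hence a
     proximal pair. *)
  have swap_le (p q : X * X) : (A `*` B `|` B `*` A) p ->
      (A `*` B `|` B `*` A) q -> `|(p - q).1| <= d -> `|(p - q).2| <= d ->
      `|S p - S q| <= d.
    move=> hp hq h1 h2; apply: le_trans (Snexp _ _ hp hq) _.
    by rewrite prod_normE ge_max h1.
  split => /=.
  - have [|||? _ //] := proxl_sub (S (x - h, y + h)) (S (x, y)).
    + by apply: SBA; exists (x - h, y + h).
    + by apply: SAB; exists (x, y).
    + apply: swap_le; [by right|by left| |] => /=.
        by rewrite addrAC subrr sub0r normrN hab0.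
      by rewrite addrAC subrr add0r hab0.
  - have [|||_ ? //] := proxl_sub (S (y, x)) (S (y + h, x - h)).
    + by apply: SBA; exists (y, x).
    + by apply: SAB; exists (y + h, x - h).
    + apply: swap_le; [by right|by left| |] => /=.
        by rewrite opprD addrA subrr sub0r normrN hab0.
      by rewrite opprB addrCA subrr addr0 hab0.
have K0 : (proxl A B `*` proxr A B) (a0, b0).
  by split; split => //; [exists b0|exists a0].
have [|||[x y] [/= [Ax _] [By _]] [fx fy]] :=
  @compact_starshaped_nonexpansive_fixpoint _ _
    (proxl A B `*` proxr A B) (ex_intro _ _ K0) Kcpt _ f K0.
- move=> t p t0 t1 [pl pr]; have [K0l K0r] := K0.
  by split; [exact: proxl_convex|exact: proxr_convex].
- exact: f_prox.
- move=> p q [/= [Ap _] [Bp _]] [/= [Aq _] [Bq _]].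
  (* The translations cancel in [f p - f q], and the max norm is invariant under swapping
     coordinates. *)
  rewrite [leLHS]prod_normE ge_max /= opprD addrACA subrr addr0.
  rewrite (Snexp p q) /=; [|by left|by left].
  rewrite [- (_ - h)]opprB addrA subrK.
  apply: le_trans (Snexp (p.2, p.1) (q.2, q.1) _ _) _; [by right|by right|].
  by rewrite !prod_normE /= maxC.
(* The fixed point equations read [x = S (x, y) + h] and [y = S (y, x) - h], and [h] has norm
   [d]. *)
exists (x, y); split => //=.
- by rewrite -{1}fx addrAC subrr add0r hab0.
- by rewrite -{1}fy addrAC subrr sub0r normrN hab0.
Qed.

Theorem theorem2p9 (R : realType) (X : completeNormedModType R)
    (hX : uniformly_convex X) (A B : set X)
    (hA0 : A !=set0) (hB0 : B !=set0)
    (hAcl : closed A) (hBcl : closed B)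
    (hAbd : bounded_set A) (hBbd : bounded_set B)
    (hAcv : convex_set (A : set (convex_lmodType X)))
    (hBcv : convex_set (B : set (convex_lmodType X)))
    (hcpt : compact (proxl A B `*` proxr A B))
    (S : X * X -> X) (hS : p_cyclic_nonexpansive A B S) :
  (exists p : X * X, coupled_best_proximity_point A B S p) /\
  ulam_hyers_stable A B S.
Proof.
have [[x y] hxy] := exists_coupled_best_proximity_point hX hA0 hB0 hAcl hBcl
  hAbd hBbd hAcv hBcv hcpt hS.
split; first by exists (x, y).
move=> e u v e0 _ _ _ _.
have d0 := set_dist_ge0 hA0 hB0.
have n0 : 0 <= `|x - u| + `|y - v| by rewrite addr_ge0.
(* Here [alpha * e] equals the sum of the norms of [x - u] and [y - v], plus [e], so it dominates
   each norm; the [+ 1] keeps [alpha] positive. *)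
exists ((`|x - u| + `|y - v|) / e + 1), 1; split => //.
  by rewrite ltr_wpDl// divr_ge0// ltW.
exists x, y; rewrite mulrDl divfK ?gt_eqF//.
have := normr_ge0 (x - u); have := normr_ge0 (y - v).
by split => //; lra.
Qed.
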